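(* Let $\Gamma\subset\mathbb{R}^d$ be a free $\mathcal{S}$-module of rank $d$ that spans $\mathbb{R}^d$. The group $\operatorname{OS}(\Gamma)/\operatorname{OC}(\Gamma)$ is the direct sum of cyclic groups of prime power orders that divide $d$ (that is, each cyclic summand has prime power order, and this order divides $d$).
   Context: $\mathcal{S}\subset\mathbb{R}$ is a ring with unity (a subring of $\mathbb{R}$ containing $1$) that is also a finitely generated $\mathbb{Z}$-module. A free $\mathcal{S}$-module $\Gamma\subset\mathbb{R}^d$ of rank $d$ that spans $\mathbb{R}^d$ is the $\mathcal{S}$-span of an $\mathbb{R}$-basis of $\mathbb{R}^d$; it is a free $\mathbb{Z}$-module of finite rank. Two free $\mathbb{Z}$-modules $M,M'\subset\mathbb{R}^d$ of finite rank are commensurate, written $M\sim M'$, if $M\cap M'$ has finite index both in $M$ and in $M'$. $\operatorname{OC}(\Gamma)=\{R\in\operatorname{O}(d,\mathbb{R}):R\Gamma\sim\Gamma\}$ and $\operatorname{OS}(\Gamma)=\{R\in\operatorname{O}(d,\mathbb{R}):\alpha R\Gamma\sim\Gamma\text{ for some real }\alpha>0\}$. These are subgroups of $\operatorname{O}(d,\mathbb{R})$, and $\operatorname{OC}(\Gamma)$ is a normal subgroup of $\operatorname{OS}(\Gamma)$. Direct sums may have infinitely many (or no) summands. *)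

(* Defs.v *)
From mathcomp Require Import all_boot all_order all_algebra.
From mathcomp Require Import all_classical all_reals.

Set Implicit Arguments.
Unset Strict Implicit.
Unset Printing Implicit Defensive.

Import Order.TTheory GRing.Theory Num.Theory.
Local Open Scope classical_set_scope.
Local Open Scope ring_scope.

Definition fg_Zmodule (R : realType) (S : set R) : Prop :=
  exists (m : nat) (g : 'I_m -> R),
    S = [set \sum_(j < m) g j *~ c j | c in [set: 'I_m -> int]].

(* A free S-module of rank d that spans R^d: the S-span of an R-basis. *)
Definition spanning_free_module (R : realType) (d : nat) (S : set R)
    (Gamma : set 'cV[R]_d) : Prop :=
  exists2 b : d.-tuple 'cV[R]_d, basis_of {: 'cV[R]_d} b &
    Gamma = [set \sum_(i < d) c i *: tnth b i
            | c in [set c : 'I_d -> R | forall i, S (c i)]].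

Definition finite_index (V : zmodType) (N M : set V) : Prop :=
  finite_set [set [set x + y | y in N] | x in M].

Definition commensurate (V : zmodType) (M M' : set V) : Prop :=
  finite_index (M `&` M') M /\ finite_index (M `&` M') M'.

Definition orthogonal_group (R : realType) (d : nat) : set 'M[R]_d :=
  [set A | A^T *m A = 1%:M].

Definition OC (R : realType) (d : nat) (Gamma : set 'cV[R]_d) : set 'M[R]_d :=
  [set A | orthogonal_group A /\
           commensurate [set A *m v | v in Gamma] Gamma].

Definition OS (R : realType) (d : nat) (Gamma : set 'cV[R]_d) : set 'M[R]_d :=
  [set A | orthogonal_group A /\
           exists2 alpha : R, 0 < alpha &
             commensurate [set alpha *: (A *m v) | v in Gamma] Gamma].

(* For matrix groups N <| G, the group G / N has underlying set [coset_space G N],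
   and its group law is the product of subsets [mul_sets]. *)
Definition mul_sets (R : realType) (d : nat) (X Y : set 'M[R]_d) :
    set 'M[R]_d :=
  [set A *m B | A in X & B in Y].

Definition coset_space (R : realType) (d : nat) (G N : set 'M[R]_d) :
    set (set 'M[R]_d) :=
  [set [set A *m B | B in N] | A in G].

(* The direct sum of the Z / n i, as the finitely supported elements of their
   product.  Since 'Z_m is Z / m only for 1 < m, this requires 1 < n i. *)
Definition direct_sum_Z (I : Type) (n : I -> nat) : set (forall i, 'Z_(n i)) :=
  [set x | finite_set [set i | x i != 0]].
Arguments direct_sum_Z {I} n.

(* Main.v *)
From HB Require Import structures.
Require Import Defs.
From mathcomp Require Import all_boot all_order all_algebra.
From mathcomp Require Import all_classical all_reals.

Set Implicit Arguments.
Unset Strict Implicit.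
Unset Printing Implicit Defensive.

Import Order.TTheory GRing.Theory Num.Theory.
Local Open Scope classical_set_scope.
Local Open Scope ring_scope.

(** For [A] orthogonal and [a > 0], say that [a] is a scale of [A] when
[a A Gamma] is commensurate with [Gamma].  [OS Gamma] consists of the matrices
that have a scale and [OC Gamma] of those that have the scale 1.  Scales
multiply along products, so two elements of [OS Gamma] with a common scale lie
in the same coset of [OC Gamma].  Every identity between products of positive
reals thus becomes an identity between cosets: this is how [OS / OC] is seen
to be a group, and an abelian one ([coset_scaleM], [coset_scale_inj]).

If [a] is a scale of [A], then [n a A] maps [Gamma] into itself for some
[n > 0], so its matrix in an [S]-basis of [Gamma] has entries in [S] and its
determinant [± (n a)^d] is in [S].  Multiplication by [(n a)^d] therefore
preserves [Gamma].  The same holds for the inverse of [a A], hence [a^d] is a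
scale of the identity matrix ([scaled_by_expd]) and [OS / OC] has an exponent
dividing [d].

It remains to see that an abelian group of finite exponent [e] is a direct sum
of cyclic groups whose orders are prime powers dividing [e]
([bounded_group_direct_sum]).  By Zorn's lemma there is a maximal set [Y] of
elements of prime power order that is independent and generates a pure
subgroup [H].  If [H] were not everything, an element of maximal order in some
[p]-primary component of the quotient by [H] would lift, by purity, to an
element of the same order, and adding it to [Y] would contradict maximality
([pure_independentU], [exists_pure_basis]). *)

(** * Orders modulo a subgroup *)

Definition subgroup (V : zmodType) (H : set V) : Prop :=
  H 0 /\ forall x y, H x -> H y -> H (x - y).

Section Subgroup.
Variables (V : zmodType) (H : set V).
Hypothesis subH : subgroup H.

Lemma subgroup0 : H 0. Proof. by case: subH. Qed.

Lemma subgroupB x y : H x -> H y -> H (x - y).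
Proof. by case: subH => _; apply. Qed.

Lemma subgroupN x : H x -> H (- x).
Proof. by rewrite -sub0r; apply: subgroupB; exact: subgroup0. Qed.

Lemma subgroupD x y : H x -> H y -> H (x + y).
Proof. by move=> Hx Hy; rewrite -[y]opprK; apply/subgroupB/subgroupN. Qed.

Lemma subgroupMn x n : H x -> H (x *+ n).
Proof.
move=> Hx; elim: n => [|n IH]; first exact: subgroup0.
by rewrite mulrS; apply: subgroupD.
Qed.

(** By Bezout, [z *+ gcdn m (p ^ k)] is in [H]; this gcd is a power of [p], and
the order of [z] modulo [H] is exactly [p ^ k]. *)
Lemma order_mod_prime_power (p k m : nat) z :
    prime p -> H (z *+ p ^ k) -> ~ H (z *+ p ^ k.-1) ->
  H (z *+ m) -> (p ^ k %| m)%N.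
Proof.
move=> p_pr Hpk nHpk Hm.
have Hg : H (z *+ gcdn m (p ^ k)).
  case: (posnP m) => [->|m_gt0]; first by rewrite gcd0n.
  case: (egcdnP (p ^ k) m_gt0) => u v def_g _.
  have -> : z *+ gcdn m (p ^ k) = z *+ m *+ u - z *+ p ^ k *+ v.
    by rewrite -!mulrnA [(m * u)%N]mulnC def_g mulrnDr mulnC addrC addKr.
  by apply: subgroupB; apply: subgroupMn.
have /(dvdn_pfactor _ _ p_pr)[i le_ik def_g] := dvdn_gcdr m (p ^ k).
case: (ltngtP i k) le_ik => // [lt_ik _|eq_ik _].
  case: nHpk; have le_ik : (i <= k.-1)%N by rewrite -ltnS (ltn_predK lt_ik).
  by rewrite -(subnKC le_ik) expnD mulrnA -def_g; apply: subgroupMn.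
by rewrite -eq_ik -def_g dvdn_gcdl.
Qed.

(** The last clause says that [p ^ k] annihilates the [p]-primary component of
the quotient by [H]; the element [z] attains this exponent.  Such a [k] exists
because the order of any element modulo [H] divides [d]. *)
Lemma exists_max_order_mod (d : nat) :
    (0 < d)%N -> (forall x : V, x *+ d = 0) -> H != setT ->
  exists p k z, [/\ prime p, (0 < k)%N, H (z *+ p ^ k),
    ~ H (z *+ p ^ k.-1) & forall x j, H (x *+ p ^ j) -> H (x *+ p ^ k)].
Proof.
move=> d_gt0 dV /eqP HnT.
have [x0 Hx0] : exists x0, ~ H x0.
  apply: contrapT => /forallNP allH; apply: HnT; apply/seteqP; split=> // x _.
  exact: contrapT (allH x).
have Hd x : H (x *+ d) by rewrite dV; exact: subgroup0.
have exm : exists m, (0 < m)%N && `[< H (x0 *+ m) >].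
  by exists d; rewrite d_gt0; apply/asboolP.
case: (ex_minnP exm) => m /andP[m_gt0 /asboolP Hm] min_m.
have m_gt1 : (1 < m)%N by case: m m_gt0 Hm {min_m} => [|[]] // _; rewrite mulr1n.
set p := pdiv m; have p_pr : prime p by apply: pdiv_prime.
pose P k := (0 < k)%N && `[< exists z, H (z *+ p ^ k) /\ ~ H (z *+ p ^ k.-1) >].
have exP : exists k, P k.
  exists 1%N; apply/andP; split=> //; apply/asboolP; exists (x0 *+ (m %/ p)).
  split; first by rewrite expn1 -mulrnA divnK ?pdiv_dvd.
  rewrite [(1.-1)%N]/= expn0 mulr1n => Hmp.
  have /min_m : (0 < m %/ p)%N && `[< H (x0 *+ (m %/ p)) >].
    by rewrite divn_gt0 ?prime_gt0 // dvdn_leq ?pdiv_dvd //=; apply/asboolP.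
  by rewrite leqNgt ltn_Pdiv // prime_gt1.
have ubP k : P k -> (k <= d)%N.
  case/andP=> _ /asboolP[z [Hk nHk]].
  have := order_mod_prime_power p_pr Hk nHk (Hd z).
  move/(dvdn_leq d_gt0); apply: leq_trans; apply/ltnW/ltn_expl/prime_gt1.
  exact: p_pr.
case: (ex_maxnP exP ubP) => k /andP[k_gt0 /asboolP[z [Hz nHz]]] max_k.
exists p, k, z; split=> // x j Hj.
have exj : exists j, `[< H (x *+ p ^ j) >] by exists j; apply/asboolP.
case: (ex_minnP exj) => i /asboolP Hi min_i.
have [le_ik|lt_ki] := leqP i k.
  by rewrite -(subnKC le_ik) expnD mulrnA; apply: subgroupMn.
have i_gt0 : (0 < i)%N by apply: leq_ltn_trans lt_ki.
suff /max_k : P i by rewrite leqNgt lt_ki.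
rewrite /P i_gt0; apply/asboolP; exists x; split=> // /asboolP/min_i.
by rewrite leqNgt ltn_predL i_gt0.
Qed.

End Subgroup.

(** * Abelian groups of finite exponent *)

Definition has_order (V : zmodType) (y : V) (n : nat) : Prop :=
  forall m, y *+ m = 0 <-> (n %| m)%N.

(** A finite family from [Y] is encoded as a list with repetitions, in which
[count_mem y s] is the coefficient of [y].  For [n = 0] the condition reads: a
vanishing combination has vanishing terms, which is independence.  For any
[n], summing the [y *+ e] shows that an element of the span of [Y] divisible by
[n] in the group is already divisible by [n] in the span, which is purity.
Putting both into one condition on finite families makes it visibly stable
under unions of chains. *)
Definition pure_independent (V : zmodType) (Y : set V) : Prop :=
  forall (s : seq V) (x : V) (n : nat), [set` s] `<=` Y ->
    x *+ n = \sum_(y <- s) y ->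
  forall y, exists e, y *+ count_mem y s = y *+ (e * n).

Definition prime_power_order (V : zmodType) (y : V) : Prop :=
  exists p k, [/\ prime p, (0 < k)%N & has_order y (p ^ k)].

Definition span (V : zmodType) (Y : set V) : set V :=
  [set x | exists2 s : seq V, [set` s] `<=` Y & x = \sum_(y <- s) y].

Lemma eq_Zp_nat (n a b : nat) :
  (1 < n)%N -> (a%:R = b%:R :> 'Z_n) <-> a = b %[mod n].
Proof.
move=> n_gt1; split=> [/(congr1 (@nat_of_ord _))|eq_ab].
  by rewrite !val_Zp_nat.
by apply: val_inj; rewrite /= !val_Zp_nat.
Qed.

Lemma sum_count (V : zmodType) (s : seq V) :
  \sum_(y <- s) y = \sum_(y <- undup s) y *+ count_mem y s.
Proof.
by rewrite -(big_undup_iterop_count _ s predT id).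
Qed.

Section BoundedGroup.
Variables (V : zmodType) (d : nat).
Hypotheses (d_gt0 : (0 < d)%N) (dV : forall x : V, x *+ d = 0).

(** Multiples with coefficients in [nat] are enough to get opposites, since
[- y = y *+ d.-1]. *)
Lemma span_subgroup (Y : set V) : subgroup (span Y).
Proof.
split=> [|x y [s sY ->] [t tY ->]]; first by exists [::]; rewrite ?big_nil.
exists (s ++ flatten (nseq d.-1 t)).
  move=> v; rewrite /= mem_cat => /orP[/sY //|/flattenP[u]].
  by rewrite mem_nseq => /andP[_ /eqP->] /tY.
rewrite big_cat big_flatten /= big_nseq iter_addr_0; congr (_ + _).
apply/eqP; rewrite eq_sym -addr_eq0 -mulrSr prednK //.
exact/eqP/dV.
Qed.

(** Modulo [span Y], the element [z] has order [p ^ k], the exponent of the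
[p]-primary component, so the cyclic group generated by [z] is pure in the
quotient: if [c z] is divisible by [n], then [gcdn n (p ^ k)] divides [c], and
[c z] is already a multiple [e0 n z].  Subtracting [e0 z] from the root reduces
the condition to the one for [Y]. *)
Lemma pure_independentU (Y : set V) (z : V) (p k : nat) :
    pure_independent Y -> prime p ->
    z *+ p ^ k = 0 -> ~ span Y (z *+ p ^ k.-1) ->
    (forall x j, span Y (x *+ p ^ j) -> span Y (x *+ p ^ k)) ->
  pure_independent (z |` Y).
Proof.
move=> indepY p_pr zpk nYz max_k s x n sYz def_s.
have subY := span_subgroup Y.
have Yzpk : span Y (z *+ p ^ k) by rewrite zpk; exact: subgroup0.
have ord_z m : span Y (z *+ m) -> (p ^ k %| m)%N.
  exact: order_mod_prime_power.
set c := count_mem z s; pose t := [seq y <- s | y != z].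
have tY : [set` t] `<=` Y.
  move=> y; rewrite /= mem_filter => /andP[/eqP neq_yz /sYz].
  by case.
have sum_s : \sum_(y <- s) y = z *+ c + \sum_(y <- t) y.
  rewrite big_filter (bigID (pred1 z)) /=; congr (_ + _).
  rewrite (eq_bigr (fun=> z)) => [|y /eqP //].
  by rewrite big_const_seq iter_addr_0.
have Yt : span Y (\sum_(y <- t) y) by exists t.
have [e0 def_c] : exists e0, z *+ c = z *+ (e0 * n).
  have [n0|n_gt0] := posnP n.
    exists 0%N; have /dvdnP[q ->] : (p ^ k %| c)%N.
      apply: ord_z; have -> : z *+ c = 0 - \sum_(y <- t) y.
        by apply/eqP; rewrite eq_sym subr_eq -sum_s -def_s n0.
      by apply: subgroupB => //; apply: subgroup0.
    by rewrite mulnC mulrnA zpk mul0rn.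
  (* Only the p-part of n matters: m is prime to p, and x *+ m is p-torsion
     modulo the span, hence killed by p ^ k there. *)
  set m := (n`_p^')%N; have def_n : n = (p ^ logn p n * m)%N.
    by rewrite -p_part partnC.
  have Yxm : span Y (x *+ (m * p ^ k)).
    rewrite mulrnA; apply: (max_k _ (logn p n + k)%N).
    rewrite -mulrnA expnD mulnA [(m * _)%N]mulnC -def_n mulrnA def_s sum_s.
    rewrite mulrnDl -mulrnA mulnC mulrnA zpk mul0rn add0r.
    exact: subgroupMn.
  set g := gcdn n (p ^ k); pose q := (p ^ k %/ g)%N.
  have def_pk : (p ^ k = q * g)%N by rewrite divnK ?dvdn_gcdr.
  have /dvdnP[r def_qn] : (m * p ^ k %| q * n)%N.
    rewrite Gauss_dvd; last first.
      rewrite coprime_sym; apply: (@pnat_coprime p); last exact: part_pnat.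
      by rewrite pnatX pnat_id.
    rewrite dvdn_mull ?dvdn_part //= def_pk dvdn_pmul2l ?dvdn_gcdl //.
    rewrite divn_gt0 ?gcdn_gt0 ?n_gt0 //.
    by rewrite dvdn_leq ?expn_gt0 ?prime_gt0 ?dvdn_gcdr.
  have /dvdnP[c1 def_c] : (g %| c)%N.
    have /ord_z : span Y (z *+ (q * c)).
      have -> : z *+ (q * c) = x *+ (m * p ^ k) *+ r - (\sum_(y <- t) y) *+ q.
        have -> : x *+ (m * p ^ k) *+ r = x *+ n *+ q.
          by rewrite -!mulrnA [LHS](congr1 _ (mulnC _ _)) -def_qn mulnC.
        by rewrite def_s sum_s mulrnDl addrK -mulrnA mulnC.
      by apply: subgroupB => //; apply: subgroupMn.
    rewrite def_pk dvdn_pmul2l // divn_gt0 ?gcdn_gt0 ?n_gt0 //.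
    by rewrite dvdn_leq ?expn_gt0 ?prime_gt0 ?dvdn_gcdr.
  (* Bezout: gcdn n (p ^ k) is a multiple of n modulo p ^ k, the order of z. *)
  case: (egcdnP (p ^ k) n_gt0) => u v def_g _; exists (c1 * u)%N.
  rewrite -mulnA def_g mulnDr mulrnDr -def_c mulnA mulrnA.
  by rewrite mulrnAC zpk mul0rn add0r.
move=> y; have [->|neq_yz] := eqVneq y z; first by exists e0.
have [|e def_y] := indepY t (x - z *+ e0) n tY _ y.
  by rewrite mulrnBl def_s sum_s def_c mulrnA addrAC subrr add0r.
exists e; rewrite -def_y count_filter; congr (_ *+ _).
by apply: eq_count => v /=; case: eqVneq => // ->; rewrite neq_yz.
Qed.

(** If a maximal [Y] did not generate, take [z0] of maximal order [p ^ k] modulo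
the span.  Purity, applied to [z0 *+ p ^ k], corrects [z0] by an element of the
span into some [z] that has order [p ^ k] in the group itself, and [z] can be
added to [Y]. *)
Lemma exists_pure_basis : exists Y : set V,
  [/\ pure_independent Y, Y `<=` @prime_power_order V & span Y = setT].
Proof.
pose P := [set Y | pure_independent Y /\ Y `<=` @prime_power_order V].
have chainP F : F `<=` P -> total_on F subset -> P (\bigcup_(Y in F) Y).
  move=> FP totF; split=> [s x n sF def_s y|y [Y /FP[_ ordY] /ordY //]].
  have [/count_memPn->|s_y] := boolP (y \notin s); first by exists 0%N.
  (* A finite part of the union of a chain lies in a single member of it. *)
  have [Y FY sY] : exists2 Y, F Y & [set` s] `<=` Y.
    have [Y0 FY0 _] := sF y (negbNE s_y).
    elim: s sF {def_s s_y} => [|v s IH] sF; first by exists Y0.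
    have [|Y FY sY] := IH; first by move=> w sw; apply/sF/mem_behead.
    have [Y' FY' Y'v] : (\bigcup_(Y in F) Y) v by apply: sF; rewrite /= mem_head.
    have [YY'|Y'Y] := totF _ _ FY FY'.
      by exists Y' => // w; rewrite /= inE => /orP[/eqP->|/sY/YY'].
    by exists Y => // w; rewrite /= inE => /orP[/eqP->|/sY//]; apply: Y'Y.
  by have [indepY _] := FP Y FY; apply: indepY def_s _.
have [Y [[indepY ordY] maxY]] := Zorn_bigcup chainP.
exists Y; split=> //; apply/eqP/negPn/negP => nspanY.
have subY := span_subgroup Y.
have [p [k [z0 [p_pr k_gt0 [s sY def_s] nYz0 max_k]]]] :=
  exists_max_order_mod subY d_gt0 dV nspanY.
have Ysum e (r : seq V) : [set` r] `<=` Y ->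
    span Y (\sum_(y <- r) y *+ e y).
  move=> rY; rewrite big_seq; apply: big_ind => [||y r_y].
  - exact: subgroup0.
  - exact: subgroupD.
  by apply: subgroupMn => //; exists [:: y]; rewrite ?big_seq1 // => v /=;
    rewrite inE => /eqP->; apply: rY.
have /choice[e def_e] := indepY s z0 (p ^ k)%N sY def_s.
pose z := z0 - \sum_(y <- undup s) y *+ e y.
have Yzz0 : span Y (z0 - z).
  by rewrite opprB addrC subrK; apply: Ysum => y; rewrite /= mem_undup => /sY.
have zpk : z *+ p ^ k = 0.
  rewrite mulrnBl def_s sum_count -sumrMnl -sumrB big1 // => y _.
  by rewrite def_e mulrnA subrr.
have nYz : ~ span Y (z *+ p ^ k.-1).
  move=> Yz; apply: nYz0; rewrite -[z0](subrK z) mulrnDl.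
  by apply: subgroupD => //; apply: subgroupMn.
apply: (maxY (z |` Y)); last first.
  split; first exact: (pure_independentU (p := p) (k := k)).
  move=> w [->|/ordY//]; exists p, k; split=> // m; split=> [zm|/dvdnP[q ->]].
    apply: (order_mod_prime_power subY p_pr _ nYz).
      by rewrite zpk; exact: subgroup0.
    by rewrite zm; exact: subgroup0.
  by rewrite mulnC mulrnA zpk mul0rn.
split=> [|YY]; first by move=> ?; right.
have Yz : Y z by apply: YY; left.
apply: nYz; apply: subgroupMn => //; exists [:: z]; rewrite ?big_seq1 //.
by move=> v /=; rewrite inE => /eqP->.
Qed.

(** The coordinate of an element on [y] is well defined modulo the order of
[y]: the list [s] followed by [d.-1] copies of [t] has sum [d] times the common
value, which is zero. *)
Lemma pure_independent_count (Y : set V) (s t : seq V) (y : V) (n : nat) :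
    pure_independent Y -> [set` s] `<=` Y -> [set` t] `<=` Y ->
    has_order y n -> \sum_(v <- s) v = \sum_(v <- t) v ->
  count_mem y s = count_mem y t %[mod n].
Proof.
move=> indepY sY tY ord_y eq_st.
have dvd_nd : (n %| d)%N by apply/ord_y.
pose u := s ++ flatten (nseq d.-1 t).
have uY : [set` u] `<=` Y.
  move=> v; rewrite /= mem_cat => /orP[/sY //|/flattenP[w]].
  by rewrite mem_nseq => /andP[_ /eqP->] /tY.
have sum_u : 0 *+ 0 = \sum_(v <- u) v.
  rewrite big_cat big_flatten /= big_nseq iter_addr_0 eq_st -mulrS.
  by rewrite prednK // dV.
have [e] := indepY u 0 0 uY sum_u y.
rewrite muln0 mulr0n => /ord_y.
rewrite count_cat count_flatten map_nseq sumn_nseq => dvd_n.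
apply/eqP; rewrite -(eqn_modDr (count_mem y t * d.-1)) -mulnS prednK //.
by rewrite [X in _ == X](eqP (dvdn_mull _ dvd_nd)); exact: dvd_n.
Qed.

(** The first theorem of Prüfer and Baer. The coordinates of [x] on a pure
independent generating set are read off any list [S x] of generators with sum
[x]. *)
Theorem bounded_group_direct_sum :
  exists (I : Type) (p k : I -> nat),
    (forall i : I, [/\ prime (p i), (0 < k i)%N & (p i ^ k i %| d)%N]) /\
    exists f : V -> forall i : I, 'Z_(p i ^ k i),
      set_bij setT (direct_sum_Z (fun i => p i ^ k i)%N) f /\
      forall x y, f (x + y) = (fun i => f x i + f y i).
Proof.
have [Y [indepY ordY spanY]] := exists_pure_basis.
pose I : choiceType := set_type Y.
have /choice[pk pkP] (i : I) : exists pk : nat * nat,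
    [/\ prime pk.1, (0 < pk.2)%N & has_order (val i) (pk.1 ^ pk.2)].
  by have [p [k pkP]] := ordY _ (set_valP i); exists (p, k).
pose p i := (pk i).1; pose k i := (pk i).2; pose n i := (p i ^ k i)%N.
have ord_i (i : I) : has_order (val i) (n i) by case: (pkP i).
have n_gt1 i : (1 < n i)%N.
  case: (pkP i) => p_pr k_gt0 _.
  by rewrite -(expn0 (p i)) ltn_exp2l ?prime_gt1.
have eqZ i a b := eq_Zp_nat a b (n_gt1 i).
have /choice[S S_P] x : exists s : seq V, [set` s] `<=` Y /\ x = \sum_(y <- s) y.
  by have : span Y x by [rewrite spanY]; case=> s; exists s.
pose f x i : 'Z_(p i ^ k i) := (count_mem (val i) (S x))%:R.
have fE (s : seq V) i : [set` s] `<=` Y ->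
    f (\sum_(y <- s) y) i = (count_mem (val i) s)%:R.
  move=> sY; apply/eqZ; have [SY eqS] := S_P (\sum_(y <- s) y).
  exact: (pure_independent_count indepY SY sY (ord_i i) (esym eqS)).
have fD x y i : f (x + y) i = f x i + f y i.
  have [xY def_x] := S_P x; have [yY def_y] := S_P y.
  rewrite {1}def_x {1}def_y -big_cat fE ?count_cat ?natrD // => v.
  by rewrite /= mem_cat => /orP[/xY|/yY].
have f0 i : f 0 i = 0 by rewrite -(big_nil 0 +%R predT (@id V)) fE.
have f_ker x : (forall i, f x i = 0) -> x = 0.
  move=> fx0; have [xY def_x] := S_P x; rewrite def_x sum_count big_seq.
  apply: big1 => y; rewrite mem_undup => /xY/mem_set Yy.
  have /(@eqZ _ _ 0) := fx0 (exist _ y Yy : I); rewrite mod0n => /eqP.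
  by move/(ord_i (exist _ y Yy : I)).
exists I, p, k; split=> [i|].
  by have [p_pr k_gt0 ord_pk] := pkP i; split=> //; apply/ord_pk.
exists f; split; last by move=> x y; apply/functional_extensionality_dep => i.
split.
- move=> x _; rewrite /direct_sum_Z /=.
  have [xY def_x] := S_P x.
  apply: (@sub_finite_set _ _ (val @^-1` [set` S x])).
    by move=> i /=; apply: contraNT => /count_memPn; rewrite /f => ->.
  by apply: finite_preimage => // i j _ _; apply: val_inj.
- move=> x y _ _ eq_f; apply/subr0_eq/f_ker => i.
  by apply: (addIr (f y i)); rewrite -fD subrK add0r eq_f.
move=> c /finite_seqP[t def_t].
exists (\sum_(i <- undup t) val i *+ c i) => //.
apply/functional_extensionality_dep => j.
have fMn x m : f (x *+ m) j = f x j *+ m.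
  by elim: m => [|m IH]; rewrite ?f0 // !mulrS fD IH.
have f_val i : f (val i) j = (i == j)%:R.
  rewrite -[val i](big_seq1 +%R _ id) fE ?big_seq1 /= ?addn0 //.
  by move=> v /=; rewrite inE => /eqP->; exact: set_valP.
rewrite (big_morph (f^~ j) (fun x y => fD x y j) (f0 j)).
under eq_bigr do rewrite fMn f_val.
have tE i : (i \in t) = (c i != 0).
  by have /= := congr1 (@^~ i) def_t => eq_i; apply/idP/idP; rewrite eq_i.
have [c0|cj] := eqVneq (c j) 0.
  rewrite c0 big_seq big1 // => i; rewrite mem_undup tE => ci.
  by case: (eqVneq i j) ci => [->|_ _]; rewrite ?c0 ?eqxx // mul0rn.
rewrite (bigD1_seq j) ?undup_uniq ?mem_undup ?tE //= eqxx big1 => [|i /negPf->].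
  by rewrite addr0 natr_Zp.
by rewrite mulr0n mul0rn.
Qed.

End BoundedGroup.

(** * Finite index and finitely generated groups *)

Section FiniteIndex.
Variable V : zmodType.
Implicit Types M N : set V.

Lemma subgroup_coset_eq N x x' :
  subgroup N -> N (x - x') -> [set x + y | y in N] = [set x' + y | y in N].
Proof.
move=> subN Nxx'; apply/seteqP; split=> _ [y Ny <-].
  exists (x - x' + y); first exact: subgroupD.
  by rewrite addrCA addrA subrK.
exists (y - (x - x')); first exact: subgroupB.
by rewrite opprB addrCA [x + _]addrC subrK addrC.
Qed.

(** Given a list of the cosets of [N] in [M], two of the first multiples of [x]
lie in the same one; so some [x *+ m] is in [N], where [m > 0] is at most the
length of the list and divides the factorial of this length. *)
Lemma finite_index_bounded_exponent N M :
    subgroup N -> subgroup M -> finite_index N M ->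
  exists2 n, (0 < n)%N & forall x, M x -> N (x *+ n).
Proof.
move=> subN subM /finite_seqP[cosets def_cosets].
exists (size cosets)`!; rewrite ?fact_gt0 // => x Mx.
pose C i := [set x *+ i + y | y in N].
pose Cs := [seq C i | i <- iota 0 (size cosets).+1].
have sCs : {subset Cs <= cosets}.
  move=> _ /mapP[i _ ->]; have : [set` cosets] (C i); last by [].
  by rewrite -def_cosets; exists (x *+ i) => //; apply: subgroupMn.
have nuCs : ~~ uniq Cs.
  apply/negP => /uniq_leq_size/(_ sCs).
  by rewrite size_map size_iota ltnn.
have /(uniqPn set0)[i [j [lt_ij]]] := nuCs.
rewrite size_map size_iota => lt_js.
have lt_is := ltn_trans lt_ij lt_js.
rewrite !(nth_map 0%N) ?size_iota // !nth_iota // !add0n => eqC.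
have [y Ny def_y] : C i (x *+ j).
  by rewrite eqC; exists 0; rewrite ?addr0 //; exact: subgroup0.
have Nji : N (x *+ (j - i)).
  by rewrite mulrnBr ?(ltnW lt_ij) // -def_y addrC addKr.
have /dvdnP[q ->] : (j - i %| (size cosets)`!)%N.
  by rewrite dvdn_fact // subn_gt0 lt_ij (leq_trans (leq_subr _ _)).
by rewrite mulnC mulrnA; apply: subgroupMn.
Qed.

Definition fg_group M : Prop :=
  exists (J : finType) (g : J -> V),
    M = [set \sum_j g j *~ c j | c in [set: J -> int]].

Lemma fg_group_subgroup M : fg_group M -> subgroup M.
Proof.
case=> J [g ->]; split; first by exists (fun=> 0) => //; rewrite big1.
move=> _ _ [a _ <-] [b _ <-]; exists (fun j => a j - b j) => //.
by rewrite -sumrB; apply: eq_bigr => j _; rewrite mulrzBr.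
Qed.

(** Reducing the coefficients modulo [n] changes an element of [M] by an element
of [N], so every coset is represented by coefficients smaller than [n]. *)
Lemma fg_group_finite_index N M n :
    fg_group M -> subgroup N -> (0 < n)%N -> (forall x, M x -> N (x *+ n)) ->
  finite_index N M.
Proof.
move=> [J [g def_M]] subN n_gt0 MN; rewrite /finite_index.
pose rep (r : {ffun J -> 'I_n}) := \sum_j g j *~ r j.
apply: (@sub_finite_set _ _
  ((fun r => [set rep r + y | y in N]) @` [set: {ffun J -> 'I_n}])); last first.
  exact/finite_image/finite_finset.
move=> _ [x + <-]; rewrite {1}def_M => -[c _ <-].
have nz : (n%:Z != 0) by rewrite -lt0n in n_gt0 *.
have ltr j : (`|(c j %% n)%Z|%N < n)%N.
  by rewrite -ltz_nat gez0_abs ?modz_ge0 // ltz_pmod.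
exists [ffun j => Ordinal (ltr j)] => //; apply/esym/subgroup_coset_eq => //.
have -> : \sum_j g j *~ c j - rep [ffun j => Ordinal (ltr j)] =
          (\sum_j g j *~ (c j %/ n)%Z) *+ n.
  rewrite -sumrB -sumrMnl; apply: eq_bigr => j _; rewrite ffunE /=.
  rewrite gez0_abs ?modz_ge0 // -mulrzBr {1}(divz_eq (c j) n) addrK.
  by rewrite mulrzA.
by apply: MN; rewrite def_M; exists (fun j => (c j %/ n)%Z).
Qed.

End FiniteIndex.

(** * Scales of orthogonal matrices *)

Section Commensurator.
Variables (R : realType) (d : nat) (Gamma : set 'cV[R]_d).
Implicit Types (A B T : 'M[R]_d) (X Y : set 'M[R]_d) (a b : R).

(** Commensurability of [T Gamma] and [Gamma] amounts to this property for [T]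
and its inverse ([commensurate_imageP]); unlike commensurability, it is
evidently multiplicative in [T]. *)
Definition quasi_preserves T : Prop :=
  exists2 n, (0 < n)%N & forall v, Gamma v -> Gamma (T *m v *+ n).

Lemma quasi_preservesM T U :
  quasi_preserves T -> quasi_preserves U -> quasi_preserves (T *m U).
Proof.
move=> [m m_gt0 TG] [n n_gt0 UG]; exists (n * m)%N.
  by rewrite muln_gt0 n_gt0.
move=> v Gv; have -> : T *m U *m v *+ (n * m) = T *m (U *m v *+ n) *+ m.
  by rewrite mulrnA -mulmxA -(raddfMn (mulmx T)) .
exact/TG/UG.
Qed.

Lemma quasi_preserves1 : quasi_preserves 1%:M.
Proof. by exists 1%N => // v Gv; rewrite mul1mx. Qed.

Hypothesis Gamma_fg : fg_group Gamma.

Lemma fg_group_image T : fg_group [set T *m v | v in Gamma].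
Proof.
case: Gamma_fg => J [g ->]; exists J, (fun j => T *m g j).
have TE c : T *m (\sum_j g j *~ c j) = \sum_j (T *m g j) *~ c j.
  by rewrite mulmx_sumr; apply: eq_bigr => j _; rewrite raddfMz.
by apply/seteqP; split=> [_ [_ [c _ <-] <-]|_ [c _ <-]];
  [exists c | exists (\sum_j g j *~ c j)] => //; exists c.
Qed.

Lemma commensurate_imageP T T' :
    T *m T' = 1%:M -> T' *m T = 1%:M ->
  commensurate [set T *m v | v in Gamma] Gamma <->
  quasi_preserves T /\ quasi_preserves T'.
Proof.
move=> TT' T'T; have subG := fg_group_subgroup Gamma_fg.
have subTG := fg_group_subgroup (fg_group_image T).
set TG := [set T *m v | v in Gamma] in subTG *.
have subI : subgroup (TG `&` Gamma).
  split=> [|x y [TGx Gx] [TGy Gy]]; first by split; exact: subgroup0.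
  by split; exact: subgroupB.
split=> [[/finite_index_bounded_exponent + /finite_index_bounded_exponent]|].
  move=> /(_ subI subTG)[m m_gt0 TGm] /(_ subI subG)[n n_gt0 Gn].
  split; [exists m | exists n] => // v Gv.
    by have [] : (TG `&` Gamma) (T *m v *+ m) by apply: TGm; exists v.
  have [[w Gw def_w] _] := Gn v Gv.
  by rewrite -(raddfMn (mulmx T')) /= -def_w mulmxA T'T mul1mx.
move=> [[m m_gt0 TGm] [n n_gt0 Gn]].
split.
  apply: (fg_group_finite_index (fg_group_image T) subI m_gt0) => _ [v Gv <-].
  split; last exact: TGm.
  by exists (v *+ m); [apply: subgroupMn | rewrite raddfMn].
apply: (fg_group_finite_index Gamma_fg subI n_gt0) => v Gv; split.
  exists (T' *m v *+ n); first exact: Gn.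
  by rewrite (raddfMn (mulmx T)) /= mulmxA TT' mul1mx.
exact: subgroupMn.
Qed.

(** The inverse of [a A] is written with [A^T] so that inverting [a A] exchanges
the last two conditions. *)
Definition scaled_by A a : Prop :=
  [/\ orthogonal_group A, 0 < a,
      quasi_preserves (a *: A) & quasi_preserves (a^-1 *: A^T)].

Lemma orthogonal_trK A : orthogonal_group A -> A *m A^T = 1%:M.
Proof. exact: mulmx1C. Qed.

Lemma commensurate_scaled_byP A a : orthogonal_group A -> 0 < a ->
  commensurate [set a *: (A *m v) | v in Gamma] Gamma <-> scaled_by A a.
Proof.
move=> OA a_gt0; have a_neq0 := lt0r_neq0 a_gt0.
have AAT := orthogonal_trK OA.
have -> : [set a *: (A *m v) | v in Gamma] = [set a *: A *m v | v in Gamma].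
  by apply: eq_imagel => v _; rewrite scalemxAl.
rewrite (@commensurate_imageP _ (a^-1 *: A^T)); first by split=> [[]|[]].
  by rewrite -scalemxAl -scalemxAr scalerA AAT divff // scale1r.
by rewrite -scalemxAl -scalemxAr scalerA OA mulVf // scale1r.
Qed.

Lemma OS_scaled_by A : OS Gamma A <-> exists a, scaled_by A a.
Proof.
split=> [[OA [a a_gt0 /commensurate_scaled_byP AG]]|[a Aa]].
  by exists a; apply: AG.
have [OA a_gt0 _ _] := Aa; split=> //; exists a => //.
exact/commensurate_scaled_byP.
Qed.

Lemma OC_scaled_by A : OC Gamma A <-> scaled_by A 1.
Proof.
have E : [set A *m v | v in Gamma] = [set 1 *: (A *m v) | v in Gamma].
  by apply: eq_imagel => v _; rewrite scale1r.
rewrite /OC /= E; split=> [[OA /commensurate_scaled_byP]|A1]; first exact.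
by have [OA _ _ _] := A1; split=> //; apply/commensurate_scaled_byP.
Qed.

Lemma scaled_byM A B a b :
  scaled_by A a -> scaled_by B b -> scaled_by (A *m B) (a * b).
Proof.
move=> [OA a_gt0 qA qAT] [OB b_gt0 qB qBT]; split.
- rewrite /orthogonal_group /= trmx_mul -mulmxA [A^T *m _]mulmxA OA mul1mx.
  exact: OB.
- exact: mulr_gt0.
- have -> : a * b *: (A *m B) = (a *: A) *m (b *: B).
    by rewrite -scalemxAl -scalemxAr scalerA.
  exact: quasi_preservesM.
have -> : (a * b)^-1 *: (A *m B)^T = (b^-1 *: B^T) *m (a^-1 *: A^T).
  by rewrite -scalemxAl -scalemxAr scalerA trmx_mul invfM mulrC.
exact: quasi_preservesM.
Qed.

Lemma scaled_by1 : scaled_by 1%:M 1.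
Proof.
split=> //; first by rewrite /orthogonal_group /= trmx1 mul1mx.
  by rewrite scale1r; exact: quasi_preserves1.
by rewrite trmx1 invr1 scale1r; exact: quasi_preserves1.
Qed.

Lemma scaled_byV A a : scaled_by A a -> scaled_by A^T a^-1.
Proof.
case=> OA a_gt0 qA qAT; split; rewrite ?invr_gt0 ?invrK ?trmxK //.
by rewrite /orthogonal_group /= trmxK orthogonal_trK.
Qed.

(** * Cosets and their scales *)

Definition OC_coset A : set 'M[R]_d := [set A *m B | B in OC Gamma].

Definition coset_scale X a : Prop := exists2 A, scaled_by A a & X = OC_coset A.

Lemma coset_spaceP X :
  coset_space (OS Gamma) (OC Gamma) X <-> exists a, coset_scale X a.
Proof.
split=> [[A /OS_scaled_by[a Aa] <-]|[a [A Aa ->]]]; first by exists a, A.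
by exists A => //; apply/OS_scaled_by; exists a.
Qed.

(** [B^T A] has scale [a^-1 a = 1], so it belongs to [OC Gamma]. *)
Lemma OC_coset_sub A B a : scaled_by A a -> scaled_by B a ->
  OC_coset A `<=` OC_coset B.
Proof.
move=> Aa Ba _ [C /OC_scaled_by C1 <-]; exists (B^T *m A *m C).
  have [_ a_gt0 _ _] := Aa; apply/OC_scaled_by.
  rewrite -[1]mulr1 -{1}(mulVf (lt0r_neq0 a_gt0)).
  by apply/scaled_byM => //; apply/scaled_byM => //; exact: scaled_byV.
have [OB _ _ _] := Ba; by rewrite !mulmxA orthogonal_trK // mul1mx.
Qed.

Lemma coset_scale_inj X Y a : coset_scale X a -> coset_scale Y a -> X = Y.
Proof.
move=> [A Aa ->] [B Ba ->]; apply/seteqP.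
by split; [exact: OC_coset_sub Aa Ba | exact: OC_coset_sub Ba Aa].
Qed.

Lemma OC_coset1 : OC_coset 1%:M = OC Gamma.
Proof.
apply/seteqP; split=> [_ [A OCA <-]|A OCA]; first by rewrite mul1mx.
by exists A => //; rewrite mul1mx.
Qed.

Lemma coset_scale1 : coset_scale (OC Gamma) 1.
Proof. by exists 1%:M; [exact: scaled_by1 | rewrite OC_coset1]. Qed.

(** Conjugation by an element of [OS Gamma] does not change scales, so
[OC Gamma] is normal and the product of two cosets is a coset. *)
Lemma coset_scaleM X Y a b :
  coset_scale X a -> coset_scale Y b -> coset_scale (mul_sets X Y) (a * b).
Proof.
move=> [A Aa ->] [B Bb ->]; exists (A *m B); first exact: scaled_byM.
apply/seteqP; split=> [_ [_ [C OCC <-] [_ [D OCD <-] <-]]|_ [C OCC <-]].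
  have [OB b_gt0 _ _] := Bb; exists (B^T *m C *m B *m D).
    move/OC_scaled_by: OCC => C1; move/OC_scaled_by: OCD => D1.
    apply/OC_scaled_by; rewrite -[1]mulr1; apply: scaled_byM => //.
    rewrite -{1}(mulVf (lt0r_neq0 b_gt0)) -[X in X * b]mulr1.
    by apply: scaled_byM => //; apply: scaled_byM => //; exact: scaled_byV.
  by rewrite -!mulmxA [B *m (B^T *m _)]mulmxA orthogonal_trK // mul1mx.
exists A.
  by exists 1%:M; rewrite ?mulmx1 //; apply/OC_scaled_by/scaled_by1.
by exists (B *m C); [exists C | rewrite mulmxA].
Qed.

Lemma coset_scaleV X a : coset_scale X a -> exists Y, coset_scale Y a^-1.
Proof. by case=> A /scaled_byV Aa _; exists (OC_coset A^T), A^T. Qed.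

End Commensurator.

(** * The determinant of a scale *)

Section SpanningModule.
Variables (R : realType) (d : nat) (S : set R) (Gamma : set 'cV[R]_d).
Hypothesis Gamma_free : spanning_free_module S Gamma.

(** In the coordinates of an [S]-basis, [Gamma] is the image of [S^d] under an
invertible matrix. *)
Lemma spanning_free_module_matrix :
  exists2 B : 'M[R]_d, \det B != 0 &
    Gamma = [set B *m c | c in [set c : 'cV[R]_d | forall i, S (c i 0)]].
Proof.
have [b b_basis ->] := Gamma_free.
pose B := \matrix_(i, j) tnth b j i 0.
have BE (c : 'cV[R]_d) : B *m c = \sum_j c j 0 *: tnth b j.
  apply/colP => i; rewrite mxE summxE; apply: eq_bigr => j _.
  by rewrite !mxE mulrC.
exists B.
  apply/negP; rewrite -det_tr => /det0P[u /eqP u_neq0 uB]; apply: u_neq0.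
  have /freeP b_free := basis_free b_basis.
  apply/rowP => j; rewrite [RHS]mxE; apply: (b_free (u 0)).
  rewrite -[RHS]trmx0 -uB trmx_mul trmxK BE; apply: eq_bigr => k _.
  by rewrite mxE (tnth_nth 0).
apply/seteqP; split=> [_ [c Sc <-]|_ [c Sc <-]].
  exists (\col_j c j) => [j|]; first by rewrite mxE; apply: Sc.
  by rewrite BE; apply: eq_bigr => j _; rewrite mxE.
by exists (fun j => c j 0) => //; rewrite BE.
Qed.

(** The products of the generators of [S] with the vectors of an [S]-basis
generate [Gamma]. *)
Lemma spanning_free_module_fg : fg_Zmodule S -> fg_group Gamma.
Proof.
move=> [m [g S_gen]]; have [B _ ->] := spanning_free_module_matrix.
have BE (e : 'I_d * 'I_m -> int) :
    B *m \col_i (\sum_j g j *~ e (i, j)) =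
    \sum_ij (g ij.2 *: col ij.1 B) *~ e ij.
  apply/colP => i; rewrite mxE summxE.
  under eq_bigr do rewrite mxE mulr_sumr.
  rewrite pair_bigA; apply: eq_bigr => -[k j] _ /=.
  by rewrite -scaler_int !mxE -mulrzr mulrCA mulrA mulrC mulrA.
exists ('I_d * 'I_m)%type, (fun ij => g ij.2 *: col ij.1 B).
apply/seteqP; split=> [_ [c Sc <-]|_ [e _ <-]].
  have /choice[e def_c] i : exists e : 'I_m -> int, \sum_j g j *~ e j = c i 0.
    by have := Sc i; rewrite S_gen => -[e _ <-]; exists e.
  exists (fun ij => e ij.1 ij.2) => //; rewrite -BE; congr (_ *m _).
  by apply/colP => i; rewrite mxE def_c.
exists (\col_i (\sum_j g j *~ e (i, j))); last exact: BE.
by move=> i; rewrite mxE S_gen; exists (fun j => e (i, j)).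
Qed.

Hypothesis S_ring : subring_closed (mem S).

Lemma subring_subgroup : subgroup S.
Proof.
have [S1 SB _] := S_ring.
have SBp x y : S x -> S y -> S (x - y).
  by move=> /mem_set Sx /mem_set Sy; apply/set_mem/SB.
by split=> //; rewrite -(subrr 1); apply: SBp; exact: set_mem.
Qed.

Lemma subring1 : S 1.
Proof. by have [S1 _ _] := S_ring; exact: set_mem. Qed.

Lemma subringM x y : S x -> S y -> S (x * y).
Proof.
by have [_ _ SM] := S_ring => /mem_set Sx /mem_set Sy; apply/set_mem/SM.
Qed.

Lemma det_subring (M : 'M[R]_d) : (forall i j, S (M i j)) -> S (\det M).
Proof.
move=> SM; have subS := subring_subgroup; apply: big_ind => [||s _].
- exact: subgroup0.
- exact: subgroupD.
have Sprod (f : 'I_d -> 'I_d) : S (\prod_i M i (f i)).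
  by apply: big_ind => //; [exact: subring1 | exact: subringM].
by rewrite mulr_sign; case: ifP => _; [apply: subgroupN |]; rewrite ?Sprod.
Qed.

(** In an [S]-basis of [Gamma], the matrix of [T] has its entries in [S]. *)
Lemma det_preserving (T : 'M[R]_d) :
  (forall v, Gamma v -> Gamma (T *m v)) -> S (\det T).
Proof.
have [B B_neq0 def_Gamma] := spanning_free_module_matrix => TG.
have subS := subring_subgroup.
have /choice[c def_c] j : exists c : 'cV[R]_d,
    (forall i, S (c i 0)) /\ B *m c = T *m col j B.
  have : Gamma (T *m col j B).
    apply: TG; rewrite def_Gamma; exists (delta_mx j 0); last by rewrite colE.
    move=> i; rewrite mxE.
    by case: (_ && _); [exact: subring1 | exact: subgroup0].
  by rewrite def_Gamma => -[c Sc Bc]; exists c.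
pose M := \matrix_(i, j) c j i 0.
have TB : T *m B = B *m M.
  apply/matrixP => i j; transitivity ((B *m c j) i 0).
    by rewrite (def_c j).2 !mxE; apply: eq_bigr => k _; rewrite mxE.
  by rewrite !mxE; apply: eq_bigr => k _; rewrite mxE.
have -> : \det T = \det M.
  by apply: (mulIf B_neq0); rewrite -det_mulmx TB det_mulmx mulrC.
by apply: det_subring => i j; rewrite mxE; apply: (def_c j).1.
Qed.

(** The determinant of [n a A] is [(n a)^d] up to sign and lies in [S], and
[Gamma] is stable under multiplication by elements of [S]. *)
Lemma quasi_preserves_det (A : 'M[R]_d) (a : R) :
    orthogonal_group A -> quasi_preserves Gamma (a *: A) ->
  quasi_preserves Gamma (a ^+ d *: 1%:M).
Proof.
move=> OA [n n_gt0 nG]; exists (n ^ d)%N; first by rewrite expn_gt0 n_gt0.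
have S_det : S ((n%:R * a) ^+ d * \det A).
  rewrite -detZ; apply: det_preserving => v /nG.
  by rewrite -scaler_nat scalemxAl scalerA.
have S_na : S ((n%:R * a) ^+ d).
  have : \det A ^+ 2 == 1.
    by rewrite expr2 -{1}det_tr -det_mulmx OA det1.
  rewrite sqrf_eq1 => /orP[/eqP detA|/eqP detA].
    by rewrite detA mulr1 in S_det.
  have -> : (n%:R * a) ^+ d = - ((n%:R * a) ^+ d * \det A).
    by rewrite detA mulrN1 opprK.
  exact: (subgroupN subring_subgroup S_det).
have [B _ ->] := spanning_free_module_matrix => _ [c Sc <-].
exists ((n%:R * a) ^+ d *: c).
  by move=> i; rewrite mxE; apply: subringM.
by rewrite -scaler_nat -scalemxAl mul1mx -scalemxAr scalerA exprMn natrX.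
Qed.

Lemma scaled_by_expd (A : 'M[R]_d) (a : R) :
  scaled_by Gamma A a -> scaled_by Gamma 1%:M (a ^+ d).
Proof.
move=> [OA a_gt0 qA qAT]; have [O1 _ _ _] := scaled_by1 Gamma.
split=> //; [exact: exprn_gt0 | exact: quasi_preserves_det qA |].
rewrite trmx1 -exprVn; apply: quasi_preserves_det qAT.
by rewrite /orthogonal_group /= trmxK orthogonal_trK.
Qed.

(** For [d = 0], where [d] itself would not be a positive exponent, the only
matrix is the identity and the exponent is 1. *)
Lemma exists_scale_exponent :
  exists e, [/\ (0 < e)%N, (e %| d)%N & forall (A : 'M[R]_d) (a : R),
    scaled_by Gamma A a -> scaled_by Gamma 1%:M (a ^+ e)].
Proof.
have [d0|d_gt0] := posnP d; last first.
  by exists d; split=> // A a; exact: scaled_by_expd.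
exists 1%N; split=> // A a; rewrite expr1; suff -> : A = 1%:M by [].
by apply/matrixP => -[i lt_id]; exfalso; rewrite d0 in lt_id.
Qed.

End SpanningModule.

(** * The quotient group *)

(** This turns the set of cosets, with its product of subsets, into a type to
which the theory of abelian groups applies. *)
Lemma abelian_group_zmodType (T : choiceType) (G : set T) (op : T -> T -> T)
    (e : T) :
    G e -> (forall x y, G x -> G y -> G (op x y)) ->
    (forall x y z, G x -> G y -> G z -> op x (op y z) = op (op x y) z) ->
    (forall x y, G x -> G y -> op x y = op y x) ->
    (forall x, G x -> op e x = x) ->
    (forall x, G x -> exists2 y, G y & op y x = e) ->
  exists (V : zmodType) (h : V -> T),
    [/\ set_bij setT G h, h 0 = e & forall x y, h (x + y) = op (h x) (h y)].
Proof.
move=> Ge Gop opA opC op1 opV; pose U : choiceType := set_type G.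
have GU (x : U) : G (val x) by exact: set_valP.
pose zero : U := exist _ e (mem_set Ge).
pose add (x y : U) : U :=
  exist (fun z => z \in G) (op (val x) (val y))
    (mem_set (Gop _ _ (GU x) (GU y))).
have /choice[opp oppP] (x : U) : exists y : U, add y x = zero.
  have [y Gy yx] := opV _ (GU x); exists (exist _ y (mem_set Gy)).
  exact: val_inj.
have addA : associative add by move=> x y z; apply: val_inj; exact: opA.
have addC : commutative add by move=> x y; apply: val_inj; exact: opC.
have add0 : left_id zero add by move=> x; apply: val_inj; exact: op1.
pose V : zmodType :=
  HB.pack_for zmodType (Choice.sort U) (Choice.on U)
    (GRing.isZmodule.Build U addA addC add0 oppP).
exists V, (val : U -> T); split=> //; split=> [x _|x y _ _|x Gx].
- exact: GU.
- exact: val_inj.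
by exists (exist _ x (mem_set Gx)).
Qed.

Theorem theorem3p14 (R : realType) (d : nat) (S : set R)
    (S_ring : subring_closed (mem S)) (S_fg : fg_Zmodule S)
    (Gamma : set 'cV[R]_d) (Gamma_free : spanning_free_module S Gamma) :
  exists (I : Type) (p k : I -> nat),
    (forall i : I, [/\ prime (p i), (0 < k i)%N & (p i ^ k i %| d)%N]) /\
    exists f : set 'M[R]_d -> forall i : I, 'Z_(p i ^ k i),
      set_bij (coset_space (OS Gamma) (OC Gamma))
              (direct_sum_Z (fun i => p i ^ k i)%N) f /\
      {in coset_space (OS Gamma) (OC Gamma) &, forall X Y,
         f (mul_sets X Y) = (fun i => f X i + f Y i)}.
Proof.
have Gamma_fg := spanning_free_module_fg Gamma_free S_fg.
set G := coset_space _ _.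
(* Each group axiom for cosets is checked on scales, where it holds by
   arithmetic in the positive reals. *)
have GP X : G X <-> exists a, coset_scale Gamma X a by exact: coset_spaceP.
have G_one : coset_scale Gamma (OC Gamma) 1 by exact: coset_scale1.
have GM X Y a b : coset_scale Gamma X a -> coset_scale Gamma Y b ->
  coset_scale Gamma (mul_sets X Y) (a * b) by exact: coset_scaleM.
have [V [h [[hG h_inj h_surj] h0 hD]]] :
  exists (V : zmodType) (h : V -> set 'M[R]_d),
    [/\ set_bij setT G h, h 0 = OC Gamma &
      forall x y, h (x + y) = mul_sets (h x) (h y)].
  apply: abelian_group_zmodType => [|X Y|X Y Z|X Y|X|X].
  - by apply/GP; exists 1.
  - by move=> /GP[a Xa] /GP[b Yb]; apply/GP; exists (a * b); exact: GM.
  - move=> /GP[a Xa] /GP[b Yb] /GP[c Zc].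
    apply: (@coset_scale_inj _ _ _ Gamma_fg _ _ (a * (b * c))).
      by apply: (GM) => //; exact: GM.
    by rewrite mulrA; apply: (GM) => //; exact: GM.
  - move=> /GP[a Xa] /GP[b Yb].
    apply: (@coset_scale_inj _ _ _ Gamma_fg _ _ (a * b)).
      exact: GM.
    by rewrite mulrC; exact: GM.
  - move=> /GP[a Xa]; apply: (coset_scale_inj Gamma_fg _ Xa).
    by rewrite -[a]mul1r; exact: GM.
  move=> /GP[a [A Aa def_X]].
  have Xa : coset_scale Gamma X a by exists A.
  have [Y YV] := coset_scaleV Xa; exists Y; first by apply/GP; exists a^-1.
  have [_ a_gt0 _ _] := Aa; apply: (coset_scale_inj Gamma_fg _ G_one).
  by rewrite -(mulVf (lt0r_neq0 a_gt0)); exact: GM.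
have hMn x n a :
    coset_scale Gamma (h x) a -> coset_scale Gamma (h (x *+ n)) (a ^+ n).
  move=> xa; elim: n => [|n IH]; first by rewrite h0.
  by rewrite mulrS hD exprS; exact: GM.
have [e [e_gt0 dvd_ed scale_e]] := exists_scale_exponent Gamma_free S_ring.
have eV (x : V) : x *+ e = 0.
  have /GP[a xa] := hG x I; have [A Aa _] := xa.
  apply: h_inj; rewrite ?in_setT // h0.
  apply: (coset_scale_inj Gamma_fg (hMn x e a xa)).
  by exists 1%:M; [exact: scale_e Aa | rewrite OC_coset1].
have [I [p [k [pkP [F [[F_fun F_inj F_surj] FD]]]]]] :=
  bounded_group_direct_sum e_gt0 eV.
exists I, p, k; split=> [i|].
  by have [p_pr k_gt0 dvd_e] := pkP i; split=> //; exact: dvdn_trans dvd_ed.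
have /choice[g gP] X : exists x, G X -> h x = X.
  by have [/h_surj[x _ hx]|nGX] := pselect (G X); [exists x | exists 0].
exists (fun X => F (g X)); split; first split.
- by move=> X _; exact: F_fun.
- move=> X Y /set_mem GX /set_mem GY /F_inj gXY.
  by rewrite -(gP X GX) -(gP Y GY) gXY ?in_setT.
- move=> c /F_surj[x _ <-]; exists (h x); first exact: hG.
  by congr F; apply: h_inj; rewrite ?in_setT // gP //; exact: hG.
move=> X Y /set_mem GX /set_mem GY; rewrite -FD; congr F.
apply: h_inj; rewrite ?in_setT // hD !gP //.
have [[a Xa] [b Yb]] := ((GP X).1 GX, (GP Y).1 GY).
by apply/GP; exists (a * b); exact: GM.
Qed.
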